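(* Let $k$ be an infinite field, let $S$ be a numerical semigroup, and let $E$ be a proper ideal of $S$ with multiplicity $e=e(E)=\min E>0$. Let $R=k[[S]]$ and let $I=(t^a\mid a\in E)\subseteq R$. Let $T=\{0\}\cup E$, which is a numerical semigroup with multiplicity $e$ and maximal ideal $E$, and let $F=e+S=\{e+s\mid s\in S\}$, which is an ideal of $T$. Let $a_i(F)$ and $b_i(F)$, $i=0,\dots,e-1$, be the invariants of $F$ as an ideal of the semigroup $T$ (defined in the context). Then $h(I)=1$ if and only if $a_i(F)=b_i(F)$ for every $i=0,\dots,e-1$.
   Context: A numerical semigroup is a submonoid $S$ of $(\mathbb N,+)$ with $\mathbb N\setminus S$ finite; its multiplicity is its smallest nonzero element, its maximal ideal is $S\setminus\{0\}$, and $k[[S]]\subseteq k[[t]]$ is the ring of power series whose exponents all lie in $S$. An ideal of $S$ is a non-empty subset $E\subseteq S$ with $E+S\subseteq E$; its multiplicity $e(E)$ is its smallest element. For sets of integers, $A+B=\{a+b\mid a\in A,b\in B\}$, $A-B=\{z\in\mathbb Z\mid z+B\subseteq A\}$, and $lA=A+\cdots+A$ ($l$ summands). Invariants of $F$ as an ideal of $T$: the maximal ideal of $T$ is $E$ and its multiplicity is $e$. The Apéry set of $F$ is $\{\alpha_0,\dots,\alpha_{e-1}\}$, where $\alpha_i$ is the smallest element of $F$ congruent to $i$ modulo $e$. The blow-up of $F$ is $B(F)=\bigcup_{j\ge1}\big((F+(j-1)E)-jE\big)$, where $F+0E$ means $F$. Let $\alpha'_i$ be the smallest element of $B(F)$ congruent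 to $i$ modulo $e$. Then $a_i(F)$ is the integer with $\alpha'_i+e\,a_i(F)=\alpha_i$, and $b_i(F)=\max\{l+1\mid l\ge0,\ \alpha_i\in lE+F\}$ (with $0E+F=F$). For a regular ideal $L$ of $R$ (one containing a non-zero-divisor), the Ratliff-Rush closure is $\widetilde L=\bigcup_{n\ge1}(L^{n+1}:_R L^n)$, and $h(I)=\min\{n\in\mathbb N_+ \mid I^m=\widetilde{I^m}\ \text{for all } m\ge n\}$, where $\mathbb N_+$ is the set of positive integers. *)

(* Defs.v *)
From HB Require Import structures.
From mathcomp Require Import all_boot all_order all_algebra.
From mathcomp Require Import boolp classical_sets functions cardinality.

Set Implicit Arguments.
Unset Strict Implicit.
Unset Printing Implicit Defensive.

Import Order.TTheory GRing.Theory Num.Theory.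

Local Open Scope classical_set_scope.
Local Open Scope ring_scope.

(* [x0] is a junk value, returned when there is no least (greatest) element. *)
Definition least d (X : porderType d) (x0 : X) (A : set X) : X :=
  xget x0 (A `&` lbound A).

Definition greatest d (X : porderType d) (x0 : X) (A : set X) : X :=
  xget x0 (A `&` ubound A).

Definition sumset (V : nmodType) (A B : set V) : set V :=
  [set a + b | a in A & b in B].

Definition iter_sumset (V : nmodType) (l : nat) (A : set V) : set V :=
  iter l (sumset A) [set 0].

(* The difference is taken in the integers, even for sets of naturals. *)
Definition diffset (A B : set nat) : set int :=
  [set z : int | forall b, B b -> exists2 a, A a & z + b%:Z = a%:Z].

Definition is_numerical_semigroup (S : set nat) : Prop :=
  [/\ S 0%N, (forall x y, S x -> S y -> S (x + y)%N) & finite_set (~` S)].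

Record numSemigroup := NumSemigroup {
  nsg_set :> set nat;
  nsgP : is_numerical_semigroup nsg_set }.

Definition semigroup_ideal (S : numSemigroup) (E : set nat) : Prop :=
  [/\ E !=set0, E `<=` S & sumset E S `<=` E].

Definition ideal_mult (E : set nat) : nat := least 0%N E.

Definition max_ideal (S : numSemigroup) : set nat := S `\ 0%N.

Definition semigroup_mult (S : numSemigroup) : nat := least 0%N (max_ideal S).

Lemma ideal_adjoin0_subproof (S : numSemigroup) (E : set nat) :
  semigroup_ideal S E -> is_numerical_semigroup ([set 0%N] `|` E).
Proof.
case: (nsgP S) => S0 SD Sfin [[x Ex] ES EDS]; split; first by left.
- move=> a b [->|Ea] [->|Eb]; rewrite ?add0n ?addn0; [by left|by right|by right|].
  by right; apply: EDS; exists a => //; exists b => //; exact: ES.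
- apply: (@sub_finite_set _ _ (`I_x `|` [set (x + y)%N | y in ~` S])).
    move=> y nTy; case: (ltnP y x) => [yx|xy]; [by left|right].
    exists (y - x)%N; last by rewrite subnKC.
    move=> Syx; apply: nTy; right; apply: EDS.
    by exists x => //; exists (y - x)%N => //; rewrite -[LHS]/(x + (y - x))%N subnKC.
  by rewrite finite_setU; split; [exact: finite_II|exact: finite_image].
Qed.

Definition ideal_adjoin0 (S : numSemigroup) (E : set nat)
  (hE : semigroup_ideal S E) : numSemigroup :=
  NumSemigroup (ideal_adjoin0_subproof hE).

Definition blowup (T : numSemigroup) (F : set nat) : set int :=
  \bigcup_(j in [set j | (1 <= j)%N])
    diffset (sumset F (iter_sumset j.-1 (max_ideal T)))
            (iter_sumset j (max_ideal T)).

Definition apery (T : numSemigroup) (F : set nat) (i : nat) : nat :=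
  least 0%N [set x | F x /\ x = i %[mod semigroup_mult T]].

Definition blowup_apery (T : numSemigroup) (F : set nat) (i : nat) : int :=
  least 0 [set z | blowup T F z /\ (z = i%:Z %[mod (semigroup_mult T)%:Z])%Z].

(* Both terms of the difference are congruent to i modulo the multiplicity,
   so that the division is exact. *)
Definition a_inv (T : numSemigroup) (F : set nat) (i : nat) : int :=
  (((apery T F i)%:Z - blowup_apery T F i) %/ (semigroup_mult T)%:Z)%Z.

Definition b_inv (T : numSemigroup) (F : set nat) (i : nat) : nat :=
  greatest 0%N [set l.+1 | l in
    [set l | sumset (iter_sumset l (max_ideal T)) F (apery T F i)]].

Section Ideals.
Variable A : comNzRingType.
Implicit Types (G I J L : set A).

Definition ideal_gen G : set A :=
  [set x | exists (n : nat) (c g : 'I_n -> A),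
     (forall i, G (g i)) /\ x = \sum_(i < n) c i * g i].

Definition ideal_mul I J : set A := ideal_gen [set x * y | x in I & y in J].

Definition ideal_exp I (n : nat) : set A := iter n (ideal_mul I) setT.

Definition ideal_colon I J : set A := [set x | forall y, J y -> I (x * y)].

Definition ratliff_rush L : set A :=
  \bigcup_(n in [set n | (1 <= n)%N])
    ideal_colon (ideal_exp L n.+1) (ideal_exp L n).

Definition rr_index I : nat :=
  least 0%N [set n | (0 < n)%N /\
    forall m, (n <= m)%N -> ideal_exp I m = ratliff_rush (ideal_exp I m)].

End Ideals.

Record powerseries (k : Type) := PowerSeries { pscoef :> nat -> k }.

HB.instance Definition _ k := [isNew for @pscoef k].
HB.instance Definition _ (k : choiceType) := [Choice of powerseries k by <:].

Section PowerSeriesRing.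
Variable k : comNzRingType.
Implicit Types f g h : powerseries k.

Lemma ps_ext f g : (forall n, f n = g n) -> f = g.
Proof. by case: f g => f [g] /= fg; congr PowerSeries; apply: funext. Qed.

Definition ps_zero : powerseries k := PowerSeries (fun=> 0).
Definition ps_opp f := PowerSeries (fun n => - f n).
Definition ps_add f g := PowerSeries (fun n => f n + g n).

Definition ps_monomial (a : nat) : powerseries k :=
  PowerSeries (fun n => (n == a)%:R).
Definition ps_mul f g :=
  PowerSeries (fun n => \sum_(i < n.+1) f i * g (n - i)%N).

Fact ps_addA : associative ps_add.
Proof. by move=> f g h; apply: ps_ext => n; exact: addrA. Qed.
Fact ps_addC : commutative ps_add.
Proof. by move=> f g; apply: ps_ext => n; exact: addrC. Qed.
Fact ps_add0 : left_id ps_zero ps_add.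
Proof. by move=> f; apply: ps_ext => n; exact: add0r. Qed.
Fact ps_addN : left_inverse ps_zero ps_opp ps_add.
Proof. by move=> f; apply: ps_ext => n; exact: addNr. Qed.

HB.instance Definition _ :=
  GRing.isZmodule.Build (powerseries k) ps_addA ps_addC ps_add0 ps_addN.

Fact ps_mulC : commutative ps_mul.
Proof.
move=> f g; apply: ps_ext => n /=; rewrite (reindex_inj rev_ord_inj) /=.
by apply: eq_bigr => i _; rewrite subSS mulrC subKn // -ltnS.
Qed.

Fact ps_mulA : associative ps_mul.
Proof.
move=> f g h; apply: ps_ext => n /=.
pose coef3 i j := f i * (g (n - i - j)%N * h j).
transitivity (\sum_(i < n.+1) \sum_(j < n.+1 | (j <= n - i)%N) coef3 i j).
  apply: eq_bigr => i _; rewrite -[X in f i * X]/(ps_mul g h (n - i)%N).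
  rewrite ps_mulC /= big_distrr /= (big_ord_narrow_leq (leq_subr _ _)) /=.
  by apply: eq_bigr => j _; rewrite /coef3 [h j * _]mulrC.
rewrite -[RHS]/(ps_mul (ps_mul f g) h n) ps_mulC /=.
rewrite (exchange_big_dep predT) //=; apply: eq_bigr => j _.
transitivity (\sum_(i < n.+1 | (i <= n - j)%N) coef3 i j).
  apply: eq_bigl => i; rewrite -ltnS -(ltnS _ (n - j)) -!subSn ?leq_ord //.
  by rewrite -subn_gt0 -(subn_gt0 i) -!subnDA addnC.
rewrite (big_ord_narrow_leq (leq_subr _ _)) /= mulrC big_distrl /=.
by apply: eq_bigr => i _; rewrite /coef3 mulrA -!subnDA addnC.
Qed.

Fact ps_mul1 : left_id (ps_monomial 0) ps_mul.
Proof.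
move=> f; apply: ps_ext => n /=; rewrite big_ord_recl /= mul1r subn0.
by rewrite big1 ?addr0 // => i _; rewrite mul0r.
Qed.

Fact ps_mulDl : left_distributive ps_mul ps_add.
Proof.
move=> f g h; apply: ps_ext => n /=; rewrite -big_split /=.
by apply: eq_bigr => i _; rewrite mulrDl.
Qed.

Fact ps_1neq0 : ps_monomial 0 != 0 :> powerseries k.
Proof. by apply/eqP => /(congr1 (fun f => f 0%N)) /= /eqP; rewrite oner_eq0. Qed.

HB.instance Definition _ := GRing.Zmodule_isComNzRing.Build (powerseries k)
  ps_mulA ps_mulC ps_mul1 ps_mulDl ps_1neq0.

End PowerSeriesRing.

Section SemigroupRing.
Variables (k : comNzRingType) (S : numSemigroup).

Definition supported : {pred powerseries k} :=
  fun f => `[< forall n, f n != 0 -> nsg_set S n >].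

Fact supported_subring : subring_closed supported.
Proof.
case: (nsgP S) => S0 SD _; split.
- by apply/asboolP => -[//|n] /=; rewrite eqxx.
- move=> f g /asboolP Sf /asboolP Sg; apply/asboolP => n /= fgn.
  have [f0|/Sf//] := eqVneq (f n) 0.
  by apply: Sg; apply: contraNneq fgn => ->; rewrite f0 subrr.
- move=> f g /asboolP Sf /asboolP Sg; apply/asboolP => n /=.
  apply: contra_neqP => nSn; apply: big1 => i _.
  have [->|fi] := eqVneq (f i) 0; first by rewrite mul0r.
  have [->|gi] := eqVneq (g (n - i)%N) 0; first by rewrite mulr0.
  case: nSn; rewrite -(@subnKC i n) -1?ltnS //.
  exact: SD (Sf _ fi) (Sg _ gi).
Qed.

HB.instance Definition _ :=
  GRing.isSubringClosed.Build (powerseries k) supported supported_subring.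

Record semigroup_ring := SemigroupRing {
  sr_val :> powerseries k;
  sr_valP : sr_val \in supported }.

HB.instance Definition _ := [isSub for sr_val].
HB.instance Definition _ := [Choice of semigroup_ring by <:].
HB.instance Definition _ :=
  [SubChoice_isSubComNzRing of semigroup_ring by <:].

(* For E contained in S, as it is for an ideal, every t^a with a in E lies
   in k[[S]]. *)
Definition monomial_ideal (E : set nat) : set semigroup_ring :=
  ideal_gen [set f : semigroup_ring |
    exists2 a, E a & sr_val f = ps_monomial k a].

End SemigroupRing.

Arguments monomial_ideal : clear implicits.

Lemma ps_mulE (k : comNzRingType) (f g : powerseries k) n :
  (f * g) n = \sum_(i < n.+1) f i * g (n - i)%N.
Proof. by []. Qed.

Lemma least_natP (A : set nat) : A !=set0 -> (A `&` lbound A) (least 0%N A).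
Proof.
move=> [a Aa]; rewrite /least; apply: xgetPex.
have exA : exists n, `[< A n >] by exists a; apply/asboolP.
case: (ex_minnP exA) => m /asboolP Am mmin; exists m; split=> // b Ab.
by rewrite leEnat; apply: mmin; apply/asboolP.
Qed.

Lemma max_ideal_adjoin0 (S : numSemigroup) (E : set nat)
    (hE : semigroup_ideal S E) :
  (0 < ideal_mult E)%N -> max_ideal (ideal_adjoin0 hE) = E.
Proof.
move=> e0; have [E0 _ _] := hE; have [_ lbE] := least_natP E0.
apply/seteqP; split=> [x [[->|//]]|x Ex]; first by case.
split; first by right.
by move=> /= x0; have := lbE _ Ex; rewrite x0 leEnat leqNgt e0.
Qed.

Lemma semigroup_mult_adjoin0 (S : numSemigroup) (E : set nat)
    (hE : semigroup_ideal S E) : (0 < ideal_mult E)%N ->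
  semigroup_mult (ideal_adjoin0 hE) = ideal_mult E.
Proof. by move=> e0; rewrite /semigroup_mult max_ideal_adjoin0. Qed.

Lemma shift_ideal (S : numSemigroup) (E : set nat) (hE : semigroup_ideal S E) :
  semigroup_ideal (ideal_adjoin0 hE) [set (ideal_mult E + s)%N | s in S].
Proof.
have [S0 SD _] := nsgP S; have [E0 ES EDS] := hE.
have [Ee _] := least_natP E0; split.
- by exists (ideal_mult E + 0)%N; exists 0%N.
- by move=> _ [s Ss <-]; right; apply: EDS; exists (ideal_mult E) => //; exists s.
- move=> _ [_ [s Ss <-] [t Tt <-]]; exists (s + t)%N; last exact: addnA.
  by apply: SD => //; case: Tt => [->|/ES].
Qed.

(* Main.v *)
Require Import Defs.
From mathcomp Require Import all_boot all_order all_algebra.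
From mathcomp Require Import boolp classical_sets functions cardinality.
From mathcomp Require Import zify.

Set Implicit Arguments.
Unset Strict Implicit.
Unset Printing Implicit Defensive.

Import Order.TTheory GRing.Theory Num.Theory.

Local Open Scope classical_set_scope.
Local Open Scope ring_scope.

(* Write lE for the l-fold sum of E, with 0E replaced by S. The elements of I^l
   are the power series supported in lE, so that the Ratliff-Rush closure of I^m
   consists of the series supported in S and in U + me, where U, the blow-up of
   E, is the increasing union of the sets jE - je. As jE = e + (j-1)E for
   large j, U is also the blow-up B(F).
   Let w and u be the least elements of S and of U in the class of i modulo e,
   and write w = u + ce. Then a_i(F) = c + 1, while b_i(F) - 1 <= c is the
   largest l such that w lies in lE. Hence a_i(F) = b_i(F) if and only if w lies
   in cE; this holds for all i exactly when the elements of S in U + me lie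
   in mE, for all m > 0, since mE is stable under adding multiples of e. *)

(** * Sumsets and extremal elements *)

Lemma mem_sumset (V : nmodType) (A B : set V) a b :
  A a -> B b -> sumset A B (a + b).
Proof. by move=> Aa Bb; exists a => //; exists b. Qed.

Lemma sumsetA (V : nmodType) : associative (@sumset V).
Proof.
move=> A B C; apply/seteqP; split.
  move=> _ [a Aa [_ [b Bb [c Cc <-]] <-]].
  by rewrite addrA; apply: mem_sumset => //; exact: mem_sumset.
move=> _ [_ [a Aa [b Bb <-]] [c Cc <-]].
by rewrite -addrA; apply: mem_sumset => //; exact: mem_sumset.
Qed.

Lemma sumset0l (V : nmodType) : left_id [set 0] (@sumset V).
Proof.
move=> A; apply/seteqP; split.
  by move=> _ [_ -> [a Aa <-]]; rewrite add0r.
by move=> a Aa; rewrite -[a]add0r; exact: mem_sumset.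
Qed.

Lemma iter_sumsetD (V : nmodType) l m (A : set V) :
  iter_sumset (l + m) A = sumset (iter_sumset l A) (iter_sumset m A).
Proof.
elim: l => [|l IHl]; first by rewrite sumset0l.
by rewrite addSn /= IHl sumsetA.
Qed.

Lemma iter_sumsetM (V : nmodType) l m (A : set V) :
  iter_sumset l (iter_sumset m A) = iter_sumset (l * m) A.
Proof. by elim: l => //= l IHl; rewrite mulSn iter_sumsetD IHl. Qed.

Lemma iter_sumset1 (V : nmodType) (A : set V) : iter_sumset 1 A = A.
Proof.
apply/seteqP; split=> [_ [a Aa [_ -> <-]]|a Aa]; first by rewrite addr0.
by rewrite -[a]addr0; exact: mem_sumset.
Qed.

Lemma mem_iter_sumsetD l m (A : set nat) x y :
  iter_sumset l A x -> iter_sumset m A y -> iter_sumset (l + m) A (x + y)%N.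
Proof. by rewrite iter_sumsetD; exact: mem_sumset. Qed.

Lemma iter_sumset_mulr l (A : set nat) a : A a -> iter_sumset l A (l * a)%N.
Proof. by move=> Aa; elim: l => //= l IHl; rewrite mulSn; exact: mem_sumset. Qed.

Lemma iter_sumset_geq l (A : set nat) a x :
  (forall b, A b -> (a <= b)%N) -> iter_sumset l A x -> (l * a <= x)%N.
Proof.
move=> leA; elim: l x => [|l IHl] x //=.
by move=> [b /leA ab [y /IHl ly <-]]; rewrite mulSn; exact: leq_add.
Qed.

Lemma least_eq d (X : porderType d) (x0 : X) (A : set X) a :
  A a -> (forall b, A b -> (a <= b)%O) -> least x0 A = a.
Proof.
move=> Aa lea; rewrite /least; case: xgetP => [y _ [Ay ley]|/(_ a)[]//].
by apply: le_anti; rewrite ley // lea.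
Qed.

Lemma greatest_eq d (X : porderType d) (x0 : X) (A : set X) a :
  A a -> (forall b, A b -> (b <= a)%O) -> greatest x0 A = a.
Proof.
move=> Aa gea; rewrite /greatest; case: xgetP => [y _ [Ay gey]|/(_ a)[]//].
by apply: le_anti; rewrite gea // gey.
Qed.

(** * Multiples of a semigroup ideal and its blow-up *)

Section Ideal.
Variables (S : numSemigroup) (E : set nat).
Hypothesis hE : semigroup_ideal S E.
Let e := ideal_mult E.
Let ES : E `<=` S. Proof. by case: hE. Qed.
Let S0 : nsg_set S 0%N. Proof. by case: (nsgP S). Qed.
Let SD x y : nsg_set S x -> nsg_set S y -> nsg_set S (x + y)%N.
Proof. by case: (nsgP S) => _ + _; apply. Qed.

Lemma ideal_multP : E e /\ forall x, E x -> (e <= x)%N.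
Proof. by have [/least_natP[Ee lbE] _ _] := hE; split=> // x /lbE. Qed.

Let Ee : E e. Proof. by case: ideal_multP. Qed.

Lemma ideal_addr x s : E x -> nsg_set S s -> E (x + s)%N.
Proof. by have [_ _ h] := hE; move=> Ex Ss; apply: h; exact: mem_sumset. Qed.

(** A summand from [E], available since [l] is positive, absorbs [s]; in contrast, [iter_sumset 0 E]
    is only {0}. *)
Lemma iter_sumset_addr l x s : (0 < l)%N ->
  iter_sumset l E x -> nsg_set S s -> iter_sumset l E (x + s)%N.
Proof.
case: l => // l _ [a Ea [b lb <-]] Ss; rewrite -[a + b]/(a + b)%N addnAC.
by apply: mem_sumset => //; exact: ideal_addr.
Qed.

Lemma iter_sumset_semigroup l x : iter_sumset l E x -> nsg_set S x.
Proof.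
elim: l x => [|l IHl] x /=; first by move->.
by move=> [a /ES Sa [b /IHl Sb <-]]; exact: SD.
Qed.

Lemma iter_sumset_ideal l : (0 < l)%N -> semigroup_ideal S (iter_sumset l E).
Proof.
move=> l0; split; first by exists (l * e)%N; exact: iter_sumset_mulr.
  exact: iter_sumset_semigroup.
by move=> _ [x lx [s Ss <-]]; exact: iter_sumset_addr.
Qed.

Lemma iter_sumset_leq l m x : (0 < m <= l)%N ->
  iter_sumset l E x -> iter_sumset m E x.
Proof.
case/andP=> m0 /subnKC <-; rewrite iter_sumsetD => -[a ma [b lb <-]].
by apply: iter_sumset_addr => //; exact: iter_sumset_semigroup lb.
Qed.

Lemma semigroup_conductor : exists c, forall n, (c <= n)%N -> nsg_set S n.
Proof.
have [_ _ /finite_seqP[s sE]] := nsgP S.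
exists (\max_(i <- s) i).+1 => n cn; apply: contrapT => nSn.
have : [set` s] n by rewrite -sE.
move=> /= ns; move: cn; rewrite ltnNge.
by rewrite (@leq_bigmax_seq _ s xpredT id n ns isT).
Qed.

(* The union of the increasing sequence jE - je, whose terms have no negative
   element as e is the minimum of E: it is the blow-up of E. *)
Definition blowup_nat : set nat :=
  [set x | exists j, iter_sumset j E (x + j * e)%N].

Lemma blowup_nat_incr j l x : (j <= l)%N ->
  iter_sumset j E (x + j * e)%N -> iter_sumset l E (x + l * e)%N.
Proof.
move=> /subnKC <- jx; rewrite mulnDl addnA.
by apply: mem_iter_sumsetD => //; exact: iter_sumset_mulr.
Qed.

(** One more copy of [e] absorbs [s] as [e + s] in [E]; this covers [l = 0] too, so [S] lies in the
    blow-up. *)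
Lemma semigroup_blowup_nat l x y s : iter_sumset l E y -> nsg_set S s ->
  (x + l * e = y + s)%N -> blowup_nat x.
Proof.
move=> ly Ss xys; exists (l + 1)%N.
have -> : (x + (l + 1) * e = y + (e + s))%N by lia.
by apply: mem_iter_sumsetD => //; rewrite iter_sumset1; exact: ideal_addr.
Qed.

(** Beyond some [c] every integer lies in [S] and is absorbed by any positive stage; the finitely
    many elements below [c] share a common stage. *)
Lemma blowup_nat_stable : exists M, forall x, blowup_nat x ->
  iter_sumset M E (x + M * e)%N.
Proof.
have [c Sc] := semigroup_conductor.
have [M HM] : exists M, forall x, (x < c)%N -> blowup_nat x ->
    iter_sumset M E (x + M * e)%N.
  elim: (c) => [|d [M HM]]; first by exists 0%N.
  have [[j jd]|nd] := pselect (blowup_nat d).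
    exists (maxn M j) => x; rewrite ltnS leq_eqVlt => /predU1P[-> _|xd Ux].
      by apply: blowup_nat_incr jd; exact: leq_maxr.
    by apply: (blowup_nat_incr (leq_maxl M j)); exact: HM.
  exists M => x; rewrite ltnS leq_eqVlt => /predU1P[->//|]; exact: HM.
exists M.+1 => x Ux; case: (ltnP x c) => [xc|/Sc Sx].
  by apply: blowup_nat_incr (leqnSn M) _; exact: HM.
rewrite addnC; apply: iter_sumset_addr => //; exact: iter_sumset_mulr.
Qed.

(* [t^e] generates a reduction of the ideal of [E]: [(M + r)E = ME + re]. *)
Lemma iter_sumset_reduction : exists M, forall r y, iter_sumset (M + r) E y ->
    exists2 z, iter_sumset M E z & y = (z + r * e)%N.
Proof.
have [M HM] := blowup_nat_stable; exists M => r y ry.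
have ley : ((M + r) * e <= y)%N.
  by apply: iter_sumset_geq ry; case: ideal_multP.
exists (y - r * e)%N; last by lia.
(* [y - (M + r)e] lies in the blow-up, so stage [M] already catches it. *)
have -> : (y - r * e = y - (M + r) * e + M * e)%N by lia.
by apply: HM; exists (M + r)%N; rewrite subnK.
Qed.

(** The left side is the exponent form of t^s lying in the Ratliff-Rush closure of I^m. Forward, the
    single test [y = nme] is enough. Conversely, the reduction trades all but [M] summands of [y]
    for copies of [e], and [j] of these are added to [s - me] to land in [jE]. *)
Lemma blowup_natP m s : (0 < m)%N ->
  (exists2 n, (0 < n)%N & forall y, iter_sumset (n * m) E y ->
     iter_sumset (n.+1 * m) E (s + y)%N) <->
  (m * e <= s)%N /\ blowup_nat (s - m * e)%N.
Proof.
move=> m0; split=> [[n n0 /(_ _ (iter_sumset_mulr (n * m) Ee)) h]|[les [j jU]]].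
  have les : (m * e <= s)%N.
    have : (n.+1 * m * e <= s + n * m * e)%N.
      by apply: iter_sumset_geq h; case: ideal_multP.
    by lia.
  split=> //; exists (n.+1 * m)%N.
  by have -> : (s - m * e + n.+1 * m * e = s + n * m * e)%N by lia.
have [M HM] := iter_sumset_reduction.
(* As [m > 0], this choice gives [n * m >= M + j]. *)
exists (M + j).+1 => // y.
have -> : ((M + j).+1 * m = M + (j + ((M + j).+1 * m - (M + j))))%N.
  by rewrite addnA subnKC //; nia.
set r := (_ - _)%N => /HM[z Mz ->].
have -> : ((M + j).+2 * m = M + (j + (m + r)))%N by rewrite /r; nia.
have -> : (s + (z + (j + r) * e) =
    z + (s - m * e + j * e + (m * e + r * e)))%N by lia.
by do !apply: mem_iter_sumsetD => //; exact: iter_sumset_mulr.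
Qed.

End Ideal.

(** * The invariants a_i(F) and b_i(F) *)

Section Invariants.
Variables (S : numSemigroup) (E : set nat) (hE : semigroup_ideal S E).
Hypothesis he : (0 < ideal_mult E)%N.
Let e := ideal_mult E.
Let T := ideal_adjoin0 hE.
Let F := [set (e + s)%N | s in S].
Let Ee : E e. Proof. by case: (ideal_multP hE). Qed.
Let S0 : nsg_set S 0%N. Proof. by case: (nsgP S). Qed.
Let maxT : max_ideal T = E. Proof. exact: max_ideal_adjoin0. Qed.
Let multT : semigroup_mult T = e. Proof. exact: semigroup_mult_adjoin0. Qed.

Lemma blowup_shift : blowup T F = [set x%:Z | x in blowup_nat E].
Proof.
rewrite /blowup maxT; apply/seteqP; split=> z.
  (* The translate of [(j+1)e] alone determines [z], as [s + y - je] with [y] in [jE]. *)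
  move=> [[//|j] _ /(_ _ (iter_sumset_mulr j.+1 Ee))] /=.
  move=> [_ [_ [s Ss <-] [y jy <-]]]; rewrite -[_ + y]/(e + s + y)%N => zE.
  have jey : (j * e <= y)%N by apply: iter_sumset_geq jy; case: (ideal_multP hE).
  exists (s + y - j * e)%N; last by lia.
  apply: (semigroup_blowup_nat hE (l := j) (y := y) (s := s)) => //.
  rewrite -/e; lia.
move=> [x [j jx <-]]; have [M HM] := iter_sumset_reduction hE.
(* Of the [j + 1] copies of [e] split off from [y], one goes to [F] and [j] go to [x], leaving a sum
   in [F + (M + j)E]. *)
exists (M + j.+1)%N => [|y /HM[v Mv ->]]; first by rewrite /= addnS.
exists (e + (v + (x + j * e)))%N; last by rewrite -/e; lia.
apply: mem_sumset; first by exists 0%N; rewrite ?addn0.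
by rewrite addnS /=; exact: mem_iter_sumsetD.
Qed.

(** Here [u] and [u + ce] are the least elements of the blow-up and of [S] in the class of [i].
    Adding [S] to [cE] encodes the convention 0E = S and changes nothing for [c > 0]. *)
Lemma inv_shift i : exists c u, [/\ blowup_nat E u,
  forall x, blowup_nat E x -> x = i %[mod e] -> exists p, x = (u + p * e)%N,
  nsg_set S (u + c * e)%N,
  forall s, nsg_set S s -> s = i %[mod e] ->
    exists q, s = (u + c * e + q * e)%N &
  a_inv T F i = (b_inv T F i)%:Z <->
    sumset (iter_sumset c E) S (u + c * e)%N].
Proof.
have next x y : (x <= y)%N -> x = i %[mod e] -> y = i %[mod e] ->
    exists p, y = (x + p * e)%N.
  move=> xy <- /eqP; rewrite eqn_mod_dvd // => /dvdnP[p pE].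
  by exists p; rewrite -pE subnKC.
have [w [Sw wi] wmin] : (exists2 w, nsg_set S w /\ w = i %[mod e] &
    forall s, nsg_set S s /\ s = i %[mod e] -> (w <= s)%N).
  have [|Aw lew] := @least_natP [set s | nsg_set S s /\ s = i %[mod e]].
    have [c Sc] := semigroup_conductor S; exists (c * e + i)%N; split.
      by apply: Sc; rewrite /e; nia.
    by rewrite modnMDl.
  exact: ex_intro2 Aw lew.
have SU s : nsg_set S s -> blowup_nat E s.
  move=> Ss; apply: (@semigroup_blowup_nat S E hE 0 s 0%N s _ Ss) => //.
  by rewrite mul0n addn0.
have [u [Uu ui] umin] : (exists2 u, blowup_nat E u /\ u = i %[mod e] &
    forall x, blowup_nat E x /\ x = i %[mod e] -> (u <= x)%N).
  have [|Au leu] := @least_natP [set x | blowup_nat E x /\ x = i %[mod e]].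
    by exists w; split; [exact: SU|].
  exact: ex_intro2 Au leu.
have [c wE] := next _ _ (umin w (conj (SU _ Sw) wi)) ui wi.
have aperyE : apery T F i = (e + w)%N.
  rewrite /apery multT; apply: least_eq.
    by split; [exists w | rewrite modnDl].
  move=> _ [[s Ss <-]]; rewrite modnDl => si.
  by rewrite leEnat leq_add2l; apply: wmin.
have blowupE : blowup_apery T F i = u%:Z.
  rewrite /blowup_apery multT blowup_shift; apply: least_eq.
    by split; [exists u | rewrite !modz_nat ui].
  move=> _ [[x Ux <-]]; rewrite !modz_nat => -[xi].
  by rewrite lez_nat; apply: umin.
(* The shift by [e] in [F] accounts for the extra 1. *)
have aE : a_inv T F i = c.+1%:Z.
  rewrite /a_inv aperyE blowupE multT wE.
  have -> : (e + (u + c * e))%:Z - u%:Z = c.+1%:Z * e%:Z by lia.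
  by rewrite mulzK // /e; lia.
have QE l : sumset (iter_sumset l E) F (e + w)%N <->
    sumset (iter_sumset l E) S w.
  split=> [[y ly [_ [s Ss <-] ysE]]|[y ly [s Ss <-]]].
    move: ysE; rewrite -[_ + _]/(y + (e + s))%N => ysE.
    have -> : w = (y + s)%N by lia.
    exact: mem_sumset.
  exists y => //; exists (e + s)%N; first by exists s.
  by rewrite -[LHS]/(y + (e + s))%N addnCA.
exists c, u; split => //; rewrite -?wE //.
- by move=> x Ux xi; apply: next => //; apply: umin.
- by move=> s Ss si; apply: next => //; apply: wmin.
rewrite aE /b_inv aperyE maxT; split=> [[]|Qc].
  (* The default value 0 differs from [c + 1], so the maximum is attained, at [l = c]. *)
  by rewrite /greatest; case: xgetP => // _ -> [[l Ql <-] _] [->]; apply/QE.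
congr (Posz _); apply/esym/greatest_eq; first by exists c => //; apply/QE.
(* If [w] lies in [lE + S], then [w - le] lies in the blow-up, so [u <= w - le] and [l <= c]. *)
move=> _ [l /QE[y ly [s Ss ysE]] <-]; rewrite leEnat ltnS.
have lw : (l * e <= w)%N.
  rewrite -ysE; apply: leq_trans (leq_addr _ _).
  by apply: iter_sumset_geq ly; case: (ideal_multP hE).
have : (u <= w - l * e)%N.
  apply: umin; split; last by rewrite -wi -[in RHS](subnK lw) addnC modnMDl.
  by apply: (semigroup_blowup_nat hE ly Ss); rewrite subnK.
by rewrite wE /e; move: he; nia.
Qed.

Lemma ratliff_rush_inv :
  (forall m s, (0 < m)%N -> nsg_set S s -> (m * e <= s)%N ->
     blowup_nat E (s - m * e)%N -> iter_sumset m E s) <->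
  (forall i, (i < e)%N -> a_inv T F i = (b_inv T F i)%:Z).
Proof.
split=> [rrE i _|abE m s m0 Ss mes Ux].
  have [c [u [Uu _ Sw _ ->]]] := inv_shift i.
  (* The hypothesis needs a positive exponent; for [c = 0] the claim is just that [u] lies in
     [S]. *)
  case: c Sw => [|c] Sw.
    by exists 0%N => //; exists u; rewrite ?mul0n ?addn0 ?add0r in Sw *.
  exists (u + c.+1 * e)%N; last by exists 0%N; rewrite ?addr0.
  by apply: rrE; rewrite ?leq_addl ?addnK.
have [c [u [_ Umin _ Smin ab]]] := inv_shift (s %% e).
have /ab[y cy [v Sv yvE]] := abE _ (ltn_pmod s he).
have [|q sE] := Smin s Ss; first by rewrite modn_mod.
have [|p xE] := Umin _ Ux.
  by rewrite modn_mod -[in RHS](subnK mes) addnC modnMDl.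
(* Both sides count the copies of [e] between [u] and [s]. Hence [c + q >= m], and [s], in
   [(c + q)E + S], lies in [mE]. *)
have cqE : (c + q = m + p)%N.
  have : (c + q) * e = (m + p) * e by lia.
  by move/eqP; rewrite eqn_pmul2r // => /eqP.
move: yvE; rewrite -[y + v]/(y + v)%N => yvE.
have -> : s = (y + q * e + v)%N by lia.
apply: (iter_sumset_addr hE) => //.
apply: (iter_sumset_leq hE (l := (c + q)%N)) => //.
  by rewrite m0 cqE leq_addr.
by apply: mem_iter_sumsetD => //; exact: iter_sumset_mulr.
Qed.

End Invariants.

(** * Ideals generated by a set *)

Section IdealGen.
Variables (A : comNzRingType) (G : set A).

Lemma ideal_gen_sub : G `<=` ideal_gen G.
Proof.
move=> x Gx; exists 1%N, (fun=> 1), (fun=> x); split=> //.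
by rewrite big_ord1 mul1r.
Qed.

Lemma ideal_gen0 : ideal_gen G 0.
Proof.
by exists 0%N, (fun=> 0), (fun=> 0); split=> [[]//|]; rewrite big_ord0.
Qed.

Lemma ideal_genD x y : ideal_gen G x -> ideal_gen G y -> ideal_gen G (x + y).
Proof.
move=> [n [c [g [Gg ->]]]] [m [d [h [Gh ->]]]].
pose glue (f1 : 'I_n -> A) (f2 : 'I_m -> A) i :=
  match fintype.split i with inl j => f1 j | inr j => f2 j end.
exists (n + m)%N, (glue c d), (glue g h); split.
  by move=> i; rewrite /glue; case: fintype.split.
rewrite big_split_ord /glue /=; congr (_ + _); apply: eq_bigr => i _.
  by rewrite (unsplitK (inl i)).
by rewrite (unsplitK (inr i)).
Qed.

Lemma ideal_genM a x : ideal_gen G x -> ideal_gen G (a * x).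
Proof.
move=> [n [c [g [Gg ->]]]]; exists n, (fun i => a * c i), g; split=> //.
by rewrite big_distrr /=; apply: eq_bigr => i _; rewrite mulrA.
Qed.

Lemma ideal_gen_min (J : set A) : J 0 ->
  (forall x y, J x -> J y -> J (x + y)) -> (forall a x, J x -> J (a * x)) ->
  G `<=` J -> ideal_gen G `<=` J.
Proof.
move=> J0 JD JM GJ _ [n [c [g [Gg ->]]]].
by elim/big_ind: _ => // i _; apply/JM/GJ.
Qed.

End IdealGen.

(** * Monomial ideals of k[[S]] in terms of exponents *)

Lemma ps_monomialM (k : comNzRingType) a (f : powerseries k) n :
  (ps_monomial k a * f) n = if (a <= n)%N then f (n - a)%N else 0.
Proof.
rewrite ps_mulE; case: ifP => an.
  rewrite (bigD1 (Ordinal (an : (a < n.+1)%N))) //= eqxx mul1r big1 ?addr0 //.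
  move=> i /eqP ia /=; case: eqP => [ia'|]; last by rewrite mul0r.
  by case: ia; exact: val_inj.
apply: big1 => i _ /=; case: eqP => [ia|]; last by rewrite mul0r.
by move: an; rewrite -ia -ltnS ltn_ord.
Qed.

Section MonomialIdeals.
Variables (k : comNzRingType) (S : numSemigroup).
Local Notation R := (semigroup_ring k S).
Implicit Types A B : set nat.

Definition supp_in A : set R := [set f | forall n, f n != 0 -> A n].

Lemma sr_ext (f g : R) : (forall n, f n = g n) -> f = g.
Proof. by move=> fg; apply/val_inj/ps_ext. Qed.

Lemma sr_supp (f : R) n : f n != 0 -> nsg_set S n.
Proof. by have /asboolP := sr_valP f; apply. Qed.

Lemma sr_lift (f : nat -> k) : (forall n, f n != 0 -> nsg_set S n) ->
  exists g : R, forall n, g n = f n.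
Proof.
move=> Sf; have fS : PowerSeries f \in supported S by apply/asboolP.
by exists (SemigroupRing fS).
Qed.

Lemma sr_monomial a : nsg_set S a -> exists t : R, sr_val t = ps_monomial k a.
Proof.
move=> Sa; have [|t tE] := @sr_lift (ps_monomial k a).
  by move=> n /=; case: (n =P a) => [->//|_]; rewrite eqxx.
by exists t; exact: ps_ext.
Qed.

Lemma supp_in0 A : supp_in A 0.
Proof. by move=> n /eqP. Qed.

Lemma supp_inD A f g : supp_in A f -> supp_in A g -> supp_in A (f + g).
Proof.
move=> Af Ag n; have [fn|/Af//] := eqVneq (f n) 0.
by move=> fgn; apply: Ag; move: fgn; rewrite /= fn add0r.
Qed.

Lemma supp_inM A B f g : supp_in A f -> supp_in B g ->
  supp_in (sumset A B) (f * g).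
Proof.
move=> Af Bg n; apply: contra_neqP => nAB; rewrite ps_mulE.
apply: big1 => i _; have [->|/Af Ai] := eqVneq (f i) 0; first by rewrite mul0r.
have [->|/Bg Bi] := eqVneq (g (n - i)%N) 0; first by rewrite mulr0.
by case: nAB; rewrite -(@subnKC i n) -1?ltnS //; exact: mem_sumset.
Qed.

Lemma supp_inT : supp_in S = setT.
Proof. by apply/seteqP; split=> // f _ n; exact: sr_supp. Qed.

Lemma supp_in_ideal_mul A f g : semigroup_ideal S A ->
  supp_in A f -> supp_in A (g * f).
Proof.
move=> [_ _ AS] Af n; rewrite mulrC => /(supp_inM Af (@sr_supp g)); exact: AS.
Qed.

(* Ideal generators only allow finite sums, but for [a] in [A] a series
   supported in [A] is a multiple of [t^a] up to a polynomial. *)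
Lemma monomial_idealE A : semigroup_ideal S A ->
  monomial_ideal k S A = supp_in A.
Proof.
move=> hA; have [[a Aa] AS _] := hA; apply/seteqP; split.
  apply: ideal_gen_min; [exact: supp_in0|exact: supp_inD| |].
    by move=> c f; exact: supp_in_ideal_mul.
  move=> f [b Ab fE] n; rewrite fE /=.
  by case: (n =P b) => [->//|_]; rewrite eqxx.
(* Polynomials: subtracting [f N] times t^N removes the top coefficient. *)
have poly N : forall f, supp_in A f -> (forall n, (N <= n)%N -> f n = 0) ->
    monomial_ideal k S A f.
  elim: N => [|N IHN] f Af f0.
    have -> : f = 0 by apply: sr_ext => n; exact: f0.
    exact: ideal_gen0.
  have [fN|fN] := eqVneq (f N) 0.
    by apply: IHN => // n; rewrite leq_eqVlt => /predU1P[<-//|]; exact: f0.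
  have [t tE] := sr_monomial (AS _ (Af _ fN)).
  have [|c cE] := @sr_lift (fun n => if n == 0%N then f N else 0).
    move=> n; case: (n =P 0%N) => [->|_]; rewrite ?eqxx // => _.
    by case: (nsgP S).
  have tcE n : (t * c) n = if n == N then f N else 0.
    rewrite -[sr_val _]/(sr_val t * sr_val c) tE ps_monomialM.
    case: (ssrnat.ltngtP N n) => [Nn|//|<-]; last by rewrite subnn cE.
    by rewrite cE subn_eq0 leqNgt Nn.
  have fE n : (f - t * c) n = if n == N then 0 else f n.
    rewrite -[LHS]/(f n - (t * c) n) tcE.
    by case: eqP => [->|]; rewrite ?subrr ?subr0.
  rewrite -[f](subrK (t * c)); apply: ideal_genD.
    apply: IHN => n; rewrite fE; case: (n =P N) => [_|nN]; rewrite ?eqxx //.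
      exact: Af.
    by move=> Nn; apply: f0; lia.
  rewrite mulrC; apply/ideal_genM/ideal_gen_sub; exists N => //; exact: Af.
move=> f Af; have [d Sd] := semigroup_conductor S.
have [t tE] := sr_monomial (AS _ Aa).
(* Cutting at [d + a] leaves only exponents at least [d], hence in [S], after division by t^a. *)
have [|g gE] := @sr_lift (fun n => if (d <= n)%N then f (n + a)%N else 0).
  by move=> n; case: ifP => [/Sd|]; rewrite ?eqxx.
have tgE n : (t * g) n = if (d + a <= n)%N then f n else 0.
  rewrite -[sr_val _]/(sr_val t * sr_val g) tE ps_monomialM.
  have [an|na] := leqP a n; first by rewrite gE leq_subRL // addnC subnK.
  by rewrite leqNgt ltn_addl.
have fE n : (f - t * g) n = if (d + a <= n)%N then 0 else f n.
  rewrite -[LHS]/(f n - (t * g) n) tgE.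
  by case: ifP; rewrite ?subrr ?subr0.
rewrite -[f](subrK (t * g)); apply: ideal_genD.
  apply: (poly (d + a)%N) => n; rewrite fE; last by move->.
  by case: ifP; rewrite ?eqxx // => _; exact: Af.
by rewrite mulrC; apply/ideal_genM/ideal_gen_sub; exists a.
Qed.

Lemma supp_in_monomial A a (t : R) :
  A a -> sr_val t = ps_monomial k a -> supp_in A t.
Proof.
by move=> Aa tE n; rewrite tE /=; case: (n =P a) => [->//|_]; rewrite eqxx.
Qed.

(** The right side is generated by monomials, and t^(a+b) = t^a t^b. *)
Lemma ideal_mul_supp_in A B : semigroup_ideal S A -> semigroup_ideal S B ->
  semigroup_ideal S (sumset A B) ->
  ideal_mul (supp_in A) (supp_in B) = supp_in (sumset A B).
Proof.
move=> [_ AS _] [_ BS _] hAB; apply/seteqP; split.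
  apply: ideal_gen_min; [exact: supp_in0|exact: supp_inD| |].
    by move=> c f; exact: supp_in_ideal_mul.
  by move=> _ [f Af [g Bg <-]]; exact: supp_inM.
rewrite -(monomial_idealE hAB).
apply: ideal_gen_min; [exact: ideal_gen0|exact: ideal_genD|exact: ideal_genM|].
move=> f [_ [a Aa [b Bb <-]] fE].
have [t tE] := sr_monomial (AS _ Aa); have [u uE] := sr_monomial (BS _ Bb).
apply: ideal_gen_sub; exists t; first exact: supp_in_monomial tE.
exists u; first exact: supp_in_monomial uE.
apply/val_inj/ps_ext => n; rewrite -[LHS]/((sr_val t * sr_val u) n) tE uE.
rewrite ps_monomialM -[val f]/(sr_val f) fE -[a + b]/(a + b)%N /=.
have [an|na] := leqP a n; first by rewrite -(eqn_add2l a) subnKC.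
by rewrite ltn_eqF // ltn_addr.
Qed.

Lemma sumset_semigroup A : semigroup_ideal S A -> sumset A S = A.
Proof.
move=> [_ _ AS]; apply/seteqP; split=> // a Aa.
by exists a => //; exists 0%N; [case: (nsgP S) | rewrite addr0].
Qed.

Lemma semigroup_idealT : semigroup_ideal S S.
Proof.
have [S0 SD _] := nsgP S; split=> //; first by exists 0%N.
by move=> _ [x Sx [y Sy <-]]; exact: SD.
Qed.

Lemma ideal_exp_supp_in A n : semigroup_ideal S A -> (0 < n)%N ->
  ideal_exp (supp_in A) n = supp_in (iter_sumset n A).
Proof.
(* The induction starts at exponent 1, with the product of [supp_in A] and the unit ideal, since
   [ideal_exp] at 0 is all of [R] but [iter_sumset 0 A] is {0}. *)
move=> hA; case: n => // n _; elim: n => [|n IHn].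
  rewrite iter_sumset1 /ideal_exp /= -supp_inT.
  rewrite ideal_mul_supp_in ?sumset_semigroup //.
  exact: semigroup_idealT.
rewrite -[LHS]/(ideal_mul _ (ideal_exp (supp_in A) n.+1)) IHn.
have hAn m := iter_sumset_ideal hA (ltn0Sn m).
by rewrite (ideal_mul_supp_in hA (hAn n) (hAn n.+1)).
Qed.

(** The monomials t^b suffice as tests: the coefficient of t^b f at [s + b] is [f s], so no
    cancellation occurs. *)
Lemma ideal_colon_supp_in A B (f : R) : B `<=` S ->
  ideal_colon (supp_in A) (supp_in B) f <->
  (forall s, f s != 0 -> forall b, B b -> A (s + b)%N).
Proof.
move=> BS; split=> [fAB s fs b Bb|fAB g Bg n].
  have [t tE] := sr_monomial (BS _ Bb).
  apply: (fAB t (supp_in_monomial Bb tE)).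
  rewrite mulrC -[sr_val _]/(sr_val t * sr_val f) tE ps_monomialM.
  by rewrite leq_addl addnK.
move/(supp_inM (A := [set s | f s != 0]) (fun _ => id) Bg).
by move=> [s fs [b Bb <-]]; exact: fAB.
Qed.

(** A series in the closure has one [n] valid for all its exponents, but membership in [supp_in A]
    is checked exponent by exponent, so it is enough to test monomials. *)
Lemma ratliff_rush_supp_in A : semigroup_ideal S A ->
  supp_in A = ratliff_rush (supp_in A) <->
  (forall s, nsg_set S s -> (exists2 n, (0 < n)%N & forall y,
     iter_sumset n A y -> iter_sumset n.+1 A (s + y)%N) -> A s).
Proof.
move=> hA.
have rrE (f : R) : ratliff_rush (supp_in A) f <-> exists2 n, (0 < n)%N &
    forall s, f s != 0 -> forall y, iter_sumset n A y ->
      iter_sumset n.+1 A (s + y)%N.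
  have nS n : (0 < n)%N -> iter_sumset n A `<=` S.
    by move=> /(iter_sumset_ideal hA)[].
  split=> -[n n0 nf]; exists n => //; move: nf.
    by rewrite !ideal_exp_supp_in // => /ideal_colon_supp_in; apply; exact: nS.
  rewrite !ideal_exp_supp_in // => nf; apply/ideal_colon_supp_in => //.
  exact: nS.
split=> [rrA s Ss [n n0 ns]|Arr].
  have [t tE] := sr_monomial Ss.
  have : supp_in A t.
    rewrite rrA; apply/rrE; exists n => // s'; rewrite tE /=.
    by case: (s' =P s) => [->|_]; rewrite ?eqxx.
  by apply; rewrite tE /= eqxx oner_eq0.
apply/seteqP; split=> f.
  move=> Af; apply/rrE; exists 1%N => // s /Af As y.
  exact: mem_sumset.
move/rrE => [n n0 nf] s fs; apply: Arr; first exact: sr_supp fs.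
by exists n => //; exact: nf.
Qed.

End MonomialIdeals.

(** * The index h(I) and the equivalence *)

Lemma rr_index_eq1 (A : comNzRingType) (I : set A) : rr_index I = 1%N <->
  forall m, (0 < m)%N -> ideal_exp I m = ratliff_rush (ideal_exp I m).
Proof.
rewrite /rr_index; split=> [|rrI]; last first.
  by apply: least_eq => [|n []].
(* The default value 0 is not 1, so the minimum is attained. *)
by rewrite /least; case: xgetP => // _ -> [[_ rrI] _] n1; rewrite n1 in rrI.
Qed.

Theorem theorem3p5 (k : fieldType) (hk : infinite_set [set: k])
  (S : numSemigroup) (E : set nat) (hE : semigroup_ideal S E)
  (hproper : E <> S) (he : (0 < ideal_mult E)%N) :
  let e := ideal_mult E in
  let I := monomial_ideal k S E in
  let T := ideal_adjoin0 hE in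
  let F := [set (e + s)%N | s in S] in
  rr_index I = 1%N <->
  forall i : nat, (i < e)%N -> a_inv T F i = (b_inv T F i)%:Z.
Proof.
move=> e I T F; rewrite rr_index_eq1 -ratliff_rush_inv //.
(* The closure criterion applied to the ideal [mE], whose [n]-fold sum is [(nm)E]. *)
have rrE m : (0 < m)%N -> ideal_exp I m = ratliff_rush (ideal_exp I m) <->
    forall s, nsg_set S s ->
      (m * e <= s)%N /\ blowup_nat E (s - m * e)%N -> iter_sumset m E s.
  move=> m0; rewrite /I monomial_idealE // ideal_exp_supp_in //.
  rewrite ratliff_rush_supp_in; last exact: (iter_sumset_ideal hE).
  split=> rr s Ss sm; apply: rr => //.
    have [n n0 ns] := (blowup_natP hE s m0).2 sm.
    by exists n => // y; rewrite !iter_sumsetM; exact: ns.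
  apply/(blowup_natP hE s m0); have [n n0 ns] := sm.
  by exists n => // y; move: (ns y); rewrite !iter_sumsetM.
split=> [rr m s m0 Ss ms Us|rr m m0].
  by apply: (rrE m m0).1 => //; exact: rr.
by apply/rrE => // s Ss [ms Us]; exact: rr.
Qed.
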